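(* Let $(X,\|\cdot\|)$ be a complex Banach space and let $p\in\mathcal{P}([0,1])$ satisfy $$\int_0^1\lambda^{p(x)}\,dx<\infty\quad\text{for all }\lambda>0.$$ If $f:\mathbb{R}\to X$ is almost automorphic, then $f$ is $S^{p(x)}$-almost automorphic. If $f:[0,\infty)\to X$ is asymptotically almost automorphic, then $f$ is asymptotically $S^{p(x)}$-almost automorphic.
   Context: Almost automorphy. A continuous function $f:\mathbb{R}\to X$ is almost automorphic iff for every real sequence $(b_n)$ there exist a subsequence $(a_n)$ of $(b_n)$ and a map $g:\mathbb{R}\to X$ such that $\lim_{n\to\infty}f(t+a_n)=g(t)$ and $\lim_{n\to\infty}g(t-a_n)=f(t)$ pointwise for $t\in\mathbb{R}$. For a Banach space $Z$, $C_0([0,\infty):Z)$ denotes the continuous functions $[0,\infty)\to Z$ tending to $0$ at $+\infty$. A function $f:[0,\infty)\to X$ is asymptotically almost automorphic iff $f(t)=g(t)+q(t)$, $t\ge 0$, for some almost automorphic $g:\mathbb{R}\to X$ and some $q\in C_0([0,\infty):X)$. Variable exponent spaces. $\mathcal{P}([0,1])$ is the set of all Lebesgue measurable functions $p:[0,1]\to[1,\infty]$. In the integral condition, $\lambda^{p(x)}=\infty$ when $p(x)=\infty$ and $\lambda>1$. For $p\in\mathcal{P}([0,1])$ and $t\ge 0$ put $\varphi_{p(x)}(t)=t^{p(x)}$ if $p(x)<\infty$; if $p(x)=\infty$, put $\varphi_{p(x)}(t)=0$ for $0\le t\le 1$ and $\varphi_{p(x)}(t)=\infty$ for $t>1$.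 For measurable $u:[0,1]\to X$ let $\rho(u)=\int_0^1\varphi_{p(x)}(\|u(x)\|)\,dx$. The space $L^{p(x)}([0,1]:X)$ consists of all measurable $u:[0,1]\to X$ with $\rho(\lambda u)<\infty$ for some $\lambda>0$ (functions equal a.e. identified), with the Luxemburg norm $\|u\|_{L^{p(x)}([0,1]:X)}=\inf\{\lambda>0:\rho(u/\lambda)\le 1\}$; it is a Banach space. Let $I=\mathbb{R}$ or $I=[0,\infty)$. $L_S^{p(x)}(I:X)$ is the space of measurable $f:I\to X$ such that $f(\cdot+t)\in L^{p(x)}([0,1]:X)$ for all $t\in I$ and $\sup_{t\in I}\|f(\cdot+t)\|_{L^{p(x)}([0,1]:X)}<\infty$. A function $f\in L_S^{p(x)}(\mathbb{R}:X)$ is $S^{p(x)}$-almost automorphic iff for every real sequence $(a_n)$ there exist a subsequence $(a_{n_k})$ and $g\in L_S^{p(x)}(\mathbb{R}:X)$ such that, for each $t\in\mathbb{R}$, $\lim_{k\to\infty}\|f(a_{n_k}+\cdot+t)-g(\cdot+t)\|_{L^{p(x)}([0,1]:X)}=0$ and $\lim_{k\to\infty}\|g(\cdot-a_{n_k}+t)-f(\cdot+t)\|_{L^{p(x)}([0,1]:X)}=0$. A function $f\in L_S^{p(x)}([0,\infty):X)$ is asymptotically $S^{p(x)}$-almost automorphic iff there exist an $S^{p(x)}$-almost automorphic $g\in L_S^{p(x)}(\mathbb{R}:X)$ and $q\in L_S^{p(x)}([0,\infty):X)$ with $f(t)=g(t)+q(t)$ for $t\ge 0$ and $\hat q\in C_0([0,\infty):L^{p(x)}([0,1]:X))$,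 where $\hat q(t):=q(t+\cdot)$. *)

(* Defs.v *)
From mathcomp Require Import all_boot all_order all_algebra.
From mathcomp Require Import all_classical all_reals all_analysis.
From mathcomp Require Import measurable_realfun.
From mathcomp Require Import complex.

Set Implicit Arguments.
Unset Strict Implicit.
Unset Printing Implicit Defensive.

Import Order.TTheory GRing.Theory Num.Theory.
Import numFieldNormedType.Exports.

Local Open Scope classical_set_scope.
Local Open Scope ring_scope.
Local Open Scope complex_scope.

(* The real line with the sigma-algebra of Lebesgue (not merely Borel)
   measurable sets, on which [completed_lebesgue_measure] is defined. *)
Notation lebesgueType R := (caratheodory_type ((@wlength R idfun)^*)%mu).

(* [0, 1] and [0, +oo[ are modelled as subsets of the line: a function on one
   of them is a total function on R whose values elsewhere are never used. *)
Definition unitI (R : realType) : set R := `[0, 1]%classic.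
Definition halfline (R : realType) : set R := `[0, +oo[%classic.
Arguments unitI R : clear implicits.
Arguments halfline R : clear implicits.

Section Spaces.
Context {R : realType} {X : completeNormedModType R[i]}.
Implicit Types (u f g q : R -> X) (p : R -> \bar R) (I : set R).

(* The library norm of a complex normed space takes its values in R[i]. *)
Definition rnorm (v : X) : R := complex.Re `|v|.

Definition variable_exponent p : Prop :=
  measurable_fun (unitI R : set (lebesgueType R)) (p : lebesgueType R -> \bar R)
  /\ forall x, unitI R x -> (1 <= p x)%E.

(* phi e t is also the reading of t^e for an extended exponent e.  For e = +oo
   that convention is only prescribed when t > 1; the values for t <= 1 do not
   affect the finiteness of an integral over [0, 1].  The case e = -oo does
   not occur for e >= 1. *)
Definition phi (e : \bar R) (t : R) : \bar R :=
  match e with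
  | r%:E => (t `^ r)%R%:E
  | +oo => if (t <= 1)%R then 0 else +oo
  | -oo => 0
  end%E.

(* Strong (Bochner) measurability: X need not be separable, and the Borel
   measurable functions into X need not be closed under addition. *)
Definition simple_function (s : R -> X) : Prop :=
  finite_set (range s) /\
  forall y, measurable (s @^-1` [set y] : set (lebesgueType R)).

Definition strongly_measurable (D : set R) u : Prop :=
  exists s : nat -> R -> X, (forall n, simple_function (s n)) /\
    {ae (@completed_lebesgue_measure R), forall x, D x ->
      s n x @[n --> \oo] --> u x}.

Definition modular p u : \bar R :=
  (\int[completed_lebesgue_measure]_(x in (unitI R : set (lebesgueType R)))
     phi (p x) (rnorm (u x)))%E.

(* Elements of the Lebesgue space are represented by functions; a.e. equality
   is accounted for by [luxemburg], which vanishes on differences of a.e. equal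
   functions. *)
Definition in_Lp p u : Prop :=
  strongly_measurable (unitI R) u /\
  exists2 l : R, 0 < l & (modular p (fun x => l%:C *: u x) < +oo)%E.

(* Extended real valued, so that the infimum of the empty set is +oo. *)
Definition luxemburg p u : \bar R :=
  ereal_inf [set l%:E | l in
    [set l : R | 0 < l /\ (modular p (fun x => (l^-1)%:C *: u x)%R <= 1)%E]].

Definition in_LS p I f : Prop :=
  [/\ strongly_measurable I f,
      forall t, I t -> in_Lp p (fun x => f (x + t)) &
      (ereal_sup [set luxemburg p (fun x => f (x + t)%R) | t in I] < +oo)%E].

Definition almost_automorphic f : Prop :=
  continuous f /\
  forall b : nat -> R, exists (n : nat -> nat) (g : R -> X),
    [/\ increasing_seq n,
        forall t, f (t + b (n k)) @[k --> \oo] --> g t &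
        forall t, g (t - b (n k)) @[k --> \oo] --> f t].

Definition C0 q : Prop :=
  {within halfline R, continuous q} /\ q t @[t --> +oo] --> (0 : X).

Definition asymptotically_almost_automorphic f : Prop :=
  exists g q, [/\ almost_automorphic g, C0 q &
    forall t, halfline R t -> f t = g t + q t].

Definition Stepanov_almost_automorphic p f : Prop :=
  in_LS p setT f /\
  forall a : nat -> R, exists (n : nat -> nat) (g : R -> X),
    [/\ increasing_seq n, in_LS p setT g,
        forall t, luxemburg p (fun x => f (a (n k) + x + t) - g (x + t))
          @[k --> \oo] --> 0%E &
        forall t, luxemburg p (fun x => g (x - a (n k) + t) - f (x + t))
          @[k --> \oo] --> 0%E].

(* C_0([0, +oo[ : L^{p(x)}([0, 1] : X)), continuity and the limit at infinity
   being those of the Luxemburg norm. *)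
Definition C0_Lp p (F : R -> R -> X) : Prop :=
  [/\ forall t, halfline R t -> in_Lp p (F t),
      forall t, halfline R t -> luxemburg p (fun x => F s x - F t x)
        @[s --> within (halfline R) (nbhs t)] --> 0%E &
      luxemburg p (F t) @[t --> +oo] --> 0%E].

Definition asymptotically_Stepanov_almost_automorphic p f : Prop :=
  in_LS p (halfline R) f /\
  exists g q, [/\ Stepanov_almost_automorphic p g, in_LS p (halfline R) q,
    forall t, halfline R t -> f t = g t + q t &
    C0_Lp p (fun t x => q (t + x))].

End Spaces.

(* Main.v *)
Require Import Defs.
From mathcomp Require Import all_boot all_order all_algebra.
From mathcomp Require Import all_classical all_reals all_analysis.
From mathcomp Require Import measurable_realfun.
From mathcomp Require Import complex unstable.
Import Order.TTheory GRing.Theory Num.Theory.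
Import numFieldNormedType.Exports.
Local Open Scope classical_set_scope.
Local Open Scope ring_scope.
Local Open Scope complex_scope.

(** An almost automorphic f is bounded, and the function g that a subsequence of
    translates of f converges to obeys the same bound.  All the differences whose
    Luxemburg norms must tend to 0 are therefore uniformly bounded and tend to 0
    pointwise.  The hypothesis on p says exactly that constants have a finite
    modular at every scale, so they can serve as dominating functions: dominated
    convergence ([luxemburg_dominated_cvg0]) upgrades the pointwise convergences
    of almost automorphy to convergences in the variable exponent space, with the
    same subsequence and the same g.

    The limit g need not be continuous, so its measurability is a genuine point.
    It is a pointwise limit of continuous functions, and each of these is close on
    large intervals to a function with finitely many values, by uniform continuity
    on compact sets; hence g is strongly measurable
    ([strongly_measurable_lim]).  Domination further requires the norms of the
    differences to be measurable, and these are pointwise limits of continuous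
    real functions ([measurable_rnorm_lim]).

    For the asymptotic statement, keep the decomposition f = g + q.  Since p >= 1
    and [0, 1] has measure 1, the Luxemburg norm of a function is at most its
    supremum on [0, 1] ([luxemburg_le_sup]); uniform continuity of q on compact
    intervals and its decay at infinity then give at once the continuity and the
    decay of t |-> q (t + _) ([C0_C0_Lp]). *)

Set Implicit Arguments.
Unset Strict Implicit.
Unset Printing Implicit Defensive.

(** * The real-valued norm *)

Section Norm.
Context {R : realType} {X : completeNormedModType R[i]}.
Implicit Types (u v w : X).

Lemma rnormE v : `|v| = (rnorm v)%:C.
Proof.
have := normr_ge0 v; rewrite /rnorm; case: `|v| => a b.
by rewrite lecE /= => /andP[/eqP -> _].
Qed.

Lemma rnorm_ge0 v : 0 <= rnorm v.
Proof. by rewrite -lecR -rnormE; exact: normr_ge0. Qed.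

Lemma rnormZ (l : R) v : rnorm (l%:C *: v) = `|l| * rnorm v.
Proof.
apply: complexI; rewrite rmorphM /= -!rnormE normrZ.
by rewrite normc_def/= expr0n/= addr0 sqrtr_sqr.
Qed.

Lemma rnormD u v : rnorm (u + v) <= rnorm u + rnorm v.
Proof. by rewrite -lecR rmorphD/= -!rnormE ler_normD. Qed.

Lemma rnormN v : rnorm (- v) = rnorm v.
Proof. by rewrite /rnorm normrN. Qed.

Lemma rnormB u v : rnorm (u - v) = rnorm (v - u).
Proof. by rewrite -rnormN opprB. Qed.

Lemma rnorm_dist u v : `|rnorm u - rnorm v| <= rnorm (u - v).
Proof.
rewrite ler_norml lerBlDr lerBrDr addrC !lerBlDr addrC; apply/andP; split.
  by rewrite rnormB -[in leLHS](subrK u v) rnormD.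
by rewrite -[in leLHS](subrK v u) rnormD.
Qed.

(** The balls of X have complex radii; positive complex numbers are real, so an
    epsilon condition with real radii suffices. *)
Lemma cvg_rnormP {T : Type} (F : set_system T) {FF : Filter F} (f : T -> X) v :
  f @ F --> v <-> forall e : R, 0 < e -> \forall x \near F, rnorm (v - f x) < e.
Proof.
split=> [/cvgrPdist_lt + e e0|H].
  move=> /(_ e%:C); rewrite ltcR => /(_ e0).
  by apply: filterS => x; rewrite rnormE ltcR.
apply/cvgrPdist_lt => -[a b]; rewrite ltcE/= => /andP[/eqP -> a0].
by have := H _ a0; apply: filterS => x; rewrite rnormE ltcR.
Qed.

Lemma cvg_rnorm {T : Type} (F : set_system T) {FF : Filter F} (f : T -> X) v :
  f @ F --> v -> rnorm (f x) @[x --> F] --> rnorm v.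
Proof.
move=> /cvg_rnormP H; apply/cvgrPdist_lt => e e0.
by have := H _ e0; apply: filterS => x; exact/le_lt_trans/rnorm_dist.
Qed.

Lemma cvg_rnormB0 {T : Type} (F : set_system T) {FF : Filter F} (f : T -> X) v :
  f @ F --> v -> rnorm (f x - v) @[x --> F] --> 0.
Proof.
move=> /cvg_rnormP H; apply/cvgrPdist_lt => e e0; have := H _ e0.
by apply: filterS => x; rewrite sub0r normrN ger0_norm ?rnorm_ge0// rnormB.
Qed.

Lemma rnorm_lim_le (F : nat -> X) v (M : R) : F k @[k --> \oo] --> v ->
  (forall k, rnorm (F k) <= M) -> rnorm v <= M.
Proof.
move=> /cvg_rnorm Fv FM; rewrite -(cvg_lim _ Fv)//.
by apply: limr_le; [apply/cvg_ex; eexists; exact: Fv|exact: nearW].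
Qed.

End Norm.

(** * Lebesgue measurability and the nonnegative integral *)

Section Lebesgue.
Context {R : realType}.
Local Notation L := (lebesgueType R).

Lemma borel_lebesgue_measurable (A : set R) :
  measurable A -> measurable (A : set L).
Proof. by move=> mA; exact: sub_caratheodory. Qed.

Lemma lebesgue_measurable_fun (D : set R) d (T : measurableType d) (h : R -> T) :
  measurable (D : set L) ->
  measurable_fun (setT : set R) h -> measurable_fun (D : set L) (h : L -> T).
Proof.
move=> mD mh _ Y mY; apply: measurableI => //.
by rewrite -[X in measurable X]setTI; apply: borel_lebesgue_measurable; exact: mh.
Qed.

Lemma measurable_unitI : measurable (unitI R : set L).
Proof. by apply: borel_lebesgue_measurable; exact: measurable_itv. Qed.

Lemma completed_lebesgue_measure_unitI :
  completed_lebesgue_measure (unitI R : set L) = 1%E.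
Proof.
transitivity (lebesgue_measure (unitI R)); first by [].
by rewrite lebesgue_measure_itv/= lte_fin ltr01 oppr0 adde0.
Qed.

End Lebesgue.

Section Integral.
Context d (T : measurableType d) (R : realType).
Context (mu : {measure set T -> \bar R}).
Import HBNNSimple.
Local Open Scope ereal_scope.

(** Monotonicity needs no measurability, because the integral of a nonnegative
    function is the supremum of the integrals of the simple functions below it.
    This is what lets Luxemburg norms be bounded above for arbitrary functions. *)
Lemma ge0_le_integral_nonmeasurable (D : set T) (f g : T -> \bar R) :
  (forall x, D x -> 0 <= f x) -> (forall x, D x -> f x <= g x) ->
  \int[mu]_(x in D) f x <= \int[mu]_(x in D) g x.
Proof.
move=> f0 fg; rewrite !ge0_integralE//; last first.
  by move=> x Dx; exact: le_trans (f0 _ Dx) (fg _ Dx).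
apply: le_ereal_sup => _ [h /= hf <-]; exists h => //= x.
by apply: le_trans (hf x) _; exact: lee_restrict.
Qed.

End Integral.

(** * The integrand of the modular *)

Section Phi.
Context {R : realType}.
Implicit Types (e : \bar R) (s t : R).

Lemma phi_ge0 e t : (0 <= phi e t)%E.
Proof. by case: e => [r| |] //=; [rewrite lee_fin powR_ge0|case: ifP]. Qed.

Lemma phi_le e s t : (1 <= e)%E -> 0 <= s -> s <= t -> (phi e s <= phi e t)%E.
Proof.
case: e => [r| |] //= r1 s0 st.
  rewrite lee_fin; apply: ge0_ler_powR => //; rewrite ?nnegrE//.
    exact: le_trans ler01 r1.
  exact: le_trans s0 st.
by have [t1|t1] := leP t 1; [rewrite (le_trans st t1)|case: ifP].
Qed.

(** On [0, 1] the integrand lies below the identity for every exponent at least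
    1: a uniform bound on a function is then a bound on its Luxemburg norm,
    whatever the exponent. *)
Lemma phi_le_id e t : (1 <= e)%E -> 0 <= t <= 1 -> (phi e t <= t%:E)%E.
Proof.
case: e => [r| |] //= r1 /andP[t0 t1]; last by rewrite t1 lee_fin.
rewrite lee_fin; move: t0; rewrite le_eqVlt => /predU1P[<-|t0].
  by rewrite powR0// gt_eqF// (lt_le_trans ltr01)// -lee_fin.
by rewrite -[leRHS]powRr1 ?(ltW t0)// ger_powR ?t0// -lee_fin.
Qed.

Lemma phi_cvg0 e (s : nat -> R) : (1 <= e)%E -> (forall n, 0 <= s n) ->
  s n @[n --> \oo] --> 0 -> phi e (s n) @[n --> \oo] --> 0%E.
Proof.
move=> e1 s0 s_0.
apply: (@squeeze_cvge _ _ _ _ (cst 0%E) _ (EFin \o s)).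
- have /cvgrPdist_lt/(_ _ ltr01) := s_0; apply: filterS => n.
  rewrite sub0r normrN ger0_norm// => s1; rewrite phi_ge0/=.
  by rewrite phi_le_id// s0 ltW.
- exact: cvg_cst.
- by apply/fine_cvgP; split; [exact: nearW|].
Qed.

Lemma phiE e t : (1 <= e)%E ->
  phi e t = if e \is a fin_num then (t `^ fine e)%:E
            else if t <= 1 then 0%E else +oo%E.
Proof. by case: e. Qed.

(** Measurability in the exponent and the base jointly: the real power is
    x |-> exp (r ln x) away from 0, and the infinite exponents form a measurable
    set. *)
Lemma measurable_phi d (T : measurableType d) (D : set T) (p : T -> \bar R)
    (h : T -> R) : measurable D ->
  (forall x, D x -> (1 <= p x)%E) -> measurable_fun D p -> measurable_fun D h ->
  measurable_fun D (fun x => phi (p x) (h x)).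
Proof.
move=> mD p1 mp mh.
have mfin : measurable_fun D (fun x => p x \is a fin_num).
  apply: (measurable_fun_bool true) => //.
  by rewrite [X in measurable (_ `&` X)](_ : _ = [set x | p x \is a fin_num]);
     [exact: emeasurable_fin_num|].
apply: (eq_measurable_fun (fun x => if p x \is a fin_num then
   (h x `^ fine (p x))%:E else if h x <= 1 then 0%E else +oo%E)).
  by move=> x /set_mem Dx; rewrite phiE// p1.
apply: measurable_fun_if => //.
- apply: (measurable_funS mD); first by move=> x [].
  apply/measurable_EFinP.
  have mfp : measurable_fun D (fun x => fine (p x)).
    exact: (measurableT_comp (@fine_measurable _ _ measurableT) mp).
  have mz : measurable_fun D (fun x : T => (fine (p x) == 0)%:R : R).
    apply: (eq_measurable_fun
      (fun x : T => if fine (p x) == 0 then 1 else 0 : R)).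
      by move=> x _; case: (_ == _).
    by apply: measurable_fun_if => //; exact: measurable_fun_eqr.
  apply: measurable_fun_if => //.
  + exact: measurable_fun_eqr.
  + apply: (measurable_funS mD); first by move=> x [].
    exact: mz.
  + apply: (measurable_funS mD); first by move=> x [].
    apply: measurableT_comp => //; apply: measurable_funM => //.
    exact: measurableT_comp.
- apply: (measurable_funS mD); first by move=> x [].
  apply: measurable_fun_if => //; exact: measurable_fun_ler.
Qed.

End Phi.

(** * Estimates of the Luxemburg norm *)

Section Luxemburg.
Context {R : realType} {X : completeNormedModType R[i]}.
Variable p : R -> \bar R.
Hypothesis p1 : forall x, unitI R x -> (1 <= p x)%E.
Implicit Types (u : R -> X) (l : R).
Local Notation L := (lebesgueType R).

Lemma modular_le1 u l : 0 < l -> (forall x, unitI R x -> rnorm (u x) <= l) ->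
  (modular p (fun x => l^-1%:C *: u x) <= 1)%E.
Proof.
move=> l0 ul; rewrite /modular.
apply: (@le_trans _ _
  (\int[completed_lebesgue_measure]_(x in (unitI R : set L)) 1)%E).
  apply: ge0_le_integral_nonmeasurable => x Dx; first exact: phi_ge0.
  have : 0 <= rnorm (l^-1%:C *: u x) <= 1.
    rewrite rnorm_ge0/= rnormZ ger0_norm ?invr_ge0 ?(ltW l0)//.
    by rewrite mulrC ler_pdivrMr// mul1r ul.
  move=> /[dup] /(phi_le_id (p1 Dx)) le1 /andP[_ ?].
  by apply: le_trans le1 _; rewrite lee_fin.
have mD := @measurable_unitI R.
rewrite (integral_cst _ mD).
rewrite mul1e le_eqVlt; apply/orP; left; apply/eqP.
exact: completed_lebesgue_measure_unitI.
Qed.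

Lemma luxemburg_ge0 u : (0 <= luxemburg p u)%E.
Proof.
by apply: le_ereal_inf_tmp => _ /= [l [l0 _] <-]; rewrite lee_fin ltW.
Qed.

Lemma luxemburg_le u l : 0 < l ->
  (modular p (fun x => l^-1%:C *: u x) <= 1)%E -> (luxemburg p u <= l%:E)%E.
Proof. by move=> l0 ul; apply: ereal_inf_lbound; exists l. Qed.

(** The unit interval has measure 1, so the constant of the embedding of the
    bounded functions is 1. *)
Lemma luxemburg_le_sup u l : 0 < l ->
  (forall x, unitI R x -> rnorm (u x) <= l) ->
  (luxemburg p u <= l%:E)%E.
Proof. by move=> l0 ul; apply: luxemburg_le => //; exact: modular_le1. Qed.

Lemma in_Lp_bounded u l : strongly_measurable (unitI R) u ->
  (forall x, unitI R x -> rnorm (u x) <= l) -> in_Lp p u.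
Proof.
move=> mu ul; split=> //.
have l0 : 0 < Num.max l 1 by rewrite lt_max ltr01 orbT.
exists (Num.max l 1)^-1; first by rewrite invr_gt0.
apply: (@le_lt_trans _ _ 1%E); last exact: ltry.
by apply: modular_le1 => // x Dx; rewrite le_max ul.
Qed.

Lemma luxemburg_cvg0 {T : Type} (F : set_system T) {FF : Filter F}
    (U : T -> R -> X) :
  (forall e : R, 0 < e -> \forall k \near F, (luxemburg p (U k) <= e%:E)%E) ->
  luxemburg p (U k) @[k --> F] --> 0%E.
Proof.
move=> H; apply/fine_cvgP; split.
  have := H _ ltr01; apply: filterS => k k1.
  by rewrite ge0_fin_numE ?luxemburg_ge0// (le_lt_trans k1)// ltry.
apply/cvgrPdist_le => e e0; have := H _ e0; apply: filterS => k ke /=.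
rewrite sub0r normrN ger0_norm ?fine_ge0 ?luxemburg_ge0//.
rewrite -lee_fin fineK// ge0_fin_numE ?luxemburg_ge0//.
exact: le_lt_trans ke (ltry _).
Qed.

Hypothesis mp : measurable_fun (unitI R : set L) (p : L -> \bar R).
Hypothesis hint : forall l : R, 0 < l ->
  (\int[completed_lebesgue_measure]_(x in (unitI R : set L)) phi (p x) l < +oo)%E.

(** Dominated convergence in the Luxemburg norm.  For fixed e > 0 the modulars of
    U k / e tend to 0, since their integrands tend to 0 pointwise and are
    dominated by phi (p x) (B / e), for B a positive bound of the U k, which the
    hypothesis on p makes integrable; once a modular is at most 1, the norm is
    at most e. *)
Lemma luxemburg_dominated_cvg0 (U : nat -> R -> X) (M : R) :
  (forall k, measurable_fun (unitI R : set L) (fun x : L => rnorm (U k x))) ->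
  (forall k x, unitI R x -> rnorm (U k x) <= M) ->
  (forall x, unitI R x -> rnorm (U k x) @[k --> \oo] --> 0) ->
  luxemburg p (U k) @[k --> \oo] --> 0%E.
Proof.
move=> mU UM U0; apply: luxemburg_cvg0 => e e0.
(* The integrability hypothesis is for positive levels only, hence B, not M. *)
pose B := Num.max M 1.
have B0 : 0 < B by rewrite lt_max ltr01 orbT.
pose f k (x : L) := phi (p x) (rnorm ((e^-1)%:C *: U k x)).
have rE k x : rnorm ((e^-1)%:C *: U k x) = e^-1 * rnorm (U k x).
  by rewrite rnormZ ger0_norm// invr_ge0 ltW.
have mD := @measurable_unitI R.
have [] := @dominated_convergence _ _ _ (@completed_lebesgue_measure R) _ mD
  f (cst 0%E) (fun x => phi (p x) (e^-1 * B)).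
- move=> k; apply: (measurable_phi mD p1 mp).
  apply: (eq_measurable_fun (fun x : L => e^-1 * rnorm (U k x) : R)).
    by move=> x _; rewrite rE.
  by apply: measurable_funM => //; exact: measurable_cst.
- exact: measurable_cst.
- apply: aeW => x Dx; apply: phi_cvg0; [exact: p1|by move=> k; exact: rnorm_ge0|].
  under eq_fun do rewrite rE.
  have := @cvgMr _ _ _ _ _ e^-1 _ (U0 x Dx); rewrite mulr0; exact.
- apply/integrableP; split; first exact: measurable_phi.
  under eq_integral do rewrite gee0_abs ?phi_ge0//.
  by apply: hint; rewrite mulr_gt0// invr_gt0.
- apply: aeW => x k Dx; rewrite gee0_abs ?phi_ge0//; apply: phi_le => //.
  + exact: p1.
  + exact: rnorm_ge0.
  + by rewrite rE ler_pM2l ?invr_gt0// le_max UM.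
move=> _ _; rewrite integral0 => /fine_cvgP[fin /cvgrPdist_lt/(_ _ ltr01)].
move: fin; apply: filterS2 => k fin lt1; apply: luxemburg_le => //.
move: lt1; rewrite sub0r normrN ger0_norm; last first.
  by apply: fine_ge0; apply: integral_ge0 => x _; exact: phi_ge0.
by rewrite -lte_fin fineK// => /ltW.
Qed.

End Luxemburg.

(** * Strong measurability of pointwise limits of continuous functions *)

Section StrongMeas.
Context {R : realType} {X : completeNormedModType R[i]}.
Local Notation L := (lebesgueType R).

Lemma simple_function_comp (r : R -> nat) (N : nat) (h : nat -> X) :
  (forall x, (r x < N)%N) -> (forall k, measurable (r @^-1` [set k])) ->
  simple_function (h \o r).
Proof.
move=> rN mr; split.
  apply: (@sub_finite_set _ _ (h @` `I_N)); last exact/finite_image/finite_II.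
  by move=> _ [x _ <-]; exists (r x) => //=; exact: rN.
move=> y; apply: borel_lebesgue_measurable.
rewrite (_ : _ @^-1` _ = \bigcup_(k in [set k | h k = y]) (r @^-1` [set k])).
  exact: bigcup_measurable.
by apply/seteqP; split=> [x/= xy|x/= [k /= <- ->]//]; exists (r x).
Qed.

(** A one-sided form of uniform continuity on a segment: only x is confined to
    [a, b], which avoids edge effects when y is a translate or a rounding of x. *)
Lemma continuous_segment_unif (f : R -> X) (a b e : R) : continuous f -> 0 < e ->
  exists m : nat, forall x y, a <= x <= b -> `|x - y| <= m.+1%:R^-1 ->
    rnorm (f x - f y) <= e.
Proof.
move=> cf e0.
have /compact_near_coveringP/(_ nat \oo
  (fun m x => forall y, `|x - y| <= m.+1%:R^-1 -> rnorm (f x - f y) <= e) _) :=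
  @segment_compact R a b.
case=> [x0 _|M _ /(_ M (leqnn M)) H]; last first.
  by exists M => x y xab; apply: H; rewrite /= in_itv.
have /cvg_rnormP/(_ (e / 2)) := cf x0; rewrite divr_gt0// => /(_ isT).
case/nbhs_ballP => d /= d0 Hd.
have d20 : 0 < d / 2 by rewrite divr_gt0.
near=> x m => /= y xy.
have x0x : `|x0 - x| < d / 2.
  by near: x; exact: (nbhsx_ballx x0 _ d20).
have md : m.+1%:R^-1 < d / 2
  by near: m; exact: near_infty_natSinv_lt (PosNum d20).
have fx : rnorm (f x0 - f x) < e / 2.
  by apply: Hd; rewrite /ball/= (lt_trans x0x)// ltr_pdivrMr// ltr_pMr// ltr1n.
have fy : rnorm (f x0 - f y) < e / 2.
  apply: Hd; rewrite /ball/= (splitr d) -(subrK x x0) -addrA.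
  by rewrite (le_lt_trans (ler_normD _ _))// ltrD// (le_lt_trans xy).
rewrite -(subrK (f x0) (f x)) -addrA (le_trans (rnormD _ _))//.
by rewrite rnormB (splitr e) lerD// ltW.
Unshelve. all: by end_near. Qed.

(** The argument is rounded down to a grid of mesh 1 / (m + 1); it is first
    clamped to [-n, n], so that only finitely many grid points occur. *)
Lemma continuous_simple_approx (f : R -> X) (n e : R) : continuous f -> 0 < e ->
  exists s : R -> X, simple_function s /\
    forall x, `|x| <= n -> rnorm (f x - s x) <= e.
Proof.
move=> cf e0; have [m Hm] := @continuous_segment_unif f (- n) n e cf e0.
(* c x is the scaled offset of the clamped point from - n. *)
pose c (x : R) := m.+1%:R * Num.max 0 (Num.min (n + n) (x + n)).
have c0 x : 0 <= c x by rewrite mulr_ge0// le_max lexx.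
have mc : measurable_fun setT c.
  apply: measurable_funM; first exact: measurable_cst.
  apply: measurable_maxr; first exact: measurable_cst.
  apply: measurable_minr; first exact: measurable_cst.
  by apply: measurable_funD => //; exact: measurable_cst.
pose r x := Num.truncn (c x).
exists ((fun k : nat => f (k%:R / m.+1%:R - n)) \o r); split.
  apply: (@simple_function_comp _ (Num.truncn (m.+1%:R * Num.max 0 (n + n))).+1).
    move=> x; rewrite ltnS /r; apply: le_truncn.
    by rewrite ler_pM2l// ge_max !le_max !ge_min !lexx !orbT.
  move=> k.
  rewrite (_ : _ @^-1` _ = c @^-1` `[k%:R, k.+1%:R[%classic); last first.
    apply/seteqP; split=> [x /= <-|x /=]; rewrite in_itv/=.
      exact: truncn_itv.
    exact: truncn_def.
  by rewrite -[X in measurable X]setTI; apply: mc => //; exact: measurable_itv.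
move=> x xn; move: (xn); rewrite ler_norml => xn'; apply: Hm => //=.
have m0 : 0 < m.+1%:R :> R by [].
have cE : c x = m.+1%:R * (x + n).
  rewrite /c; case/andP: xn' => ? ?; congr (_ * _).
  by rewrite min_r ?lerD2r// max_r// -lerBlDr sub0r.
have /andP[] := truncn_itv (c0 x); rewrite -/(r x) cE => r1 r2.
have -> : x - ((r x)%:R / m.+1%:R - n) =
    (m.+1%:R * (x + n) - (r x)%:R) / m.+1%:R.
  by rewrite mulrBl mulrAC divff ?gt_eqF// mul1r opprB addrA addrAC.
rewrite normrM normfV (gtr0_norm m0) ler_pdivrMr// mulVf ?gt_eqF//.
by rewrite ger0_norm ?subr_ge0// lerBlDl -(natrD _ _ 1) addn1 ltW.
Qed.

(** No diagonal extraction is needed: F k is approximated by a simple function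
    within 1 / (k + 1) on [-k, k], and these simple functions have the same limit
    as F wherever F converges. *)
Lemma strongly_measurable_lim (D : set R) (F : nat -> R -> X) (g : R -> X) :
  (forall k, continuous (F k)) ->
  (forall t, D t -> F k t @[k --> \oo] --> g t) ->
  strongly_measurable D g.
Proof.
move=> cF Fg.
have /choice[s Hs] k := @continuous_simple_approx (F k) k%:R k.+1%:R^-1 (cF k)
  (ltac:(by [])).
exists s; split=> [k|]; first by case: (Hs k).
apply: aeW => x Dx; apply/cvg_rnormP => e e0.
have e20 : 0 < e / 2 by rewrite divr_gt0.
have /cvg_rnormP/(_ _ e20) := Fg x Dx.
have [M _ HM] := near_infty_natSinv_lt (PosNum e20).
move=> H; near=> k.
rewrite -(subrK (F k x) (g x)) -addrA (le_lt_trans (rnormD _ _))//.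
rewrite (splitr e) ltrD//; first by near: k.
have [_ /(_ x)] := Hs k; move/(_ _)/le_lt_trans; apply.
  by near: k; exact: nbhs_infty_ger.
by apply: HM; near: k; exists M.
Unshelve. all: by end_near. Qed.

(** Taking norms first turns the limit into one of real functions; Borel
    measurability of maps into X, poorly behaved when X is not separable, is thus
    avoided. *)
Lemma measurable_rnorm_lim (F : nat -> R -> X) (g : R -> X) :
  (forall k, continuous (F k)) -> (forall t, F k t @[k --> \oo] --> g t) ->
  measurable_fun (unitI R : set L) (fun x : L => rnorm (g x)).
Proof.
move=> cF Fg; apply: (lebesgue_measurable_fun (@measurable_unitI R)).
apply: (measurable_fun_cvg (h := fun k x => rnorm (F k x))).
  move=> k; apply: continuous_measurable_fun => x; apply: cvg_rnorm; exact: cF.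
by move=> x _; apply: cvg_rnorm; exact: Fg.
Qed.

End StrongMeas.

(** * From almost automorphy to its Stepanov version *)

Section AlmostAutomorphic.
Context {R : realType} {X : completeNormedModType R[i]}.
Implicit Types (f g q : R -> X).
Local Notation L := (lebesgueType R).

(** If f exceeded k in norm at some b k for every k, then no subsequence of
    f (0 + b k) could converge. *)
Lemma almost_automorphic_bounded f : almost_automorphic f ->
  exists M : R, forall t, rnorm (f t) <= M.
Proof.
move=> [_ aaf]; apply: contrapT => /forallNP H.
have /choice[b Hb] (k : nat) : exists t, k%:R < rnorm (f t).
  have /existsNP[t /negP] := H k%:R.
  by rewrite -ltNge => ?; exists t.
have [n [g [incn + _]]] := aaf b.
move=> /(_ 0)/cvg_rnorm/cvgrPdist_lt/(_ _ ltr01) [N _ HN].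
pose k := maxn N (Num.truncn (rnorm (g 0) + 1)).+1.
have := HN k (leq_maxl _ _); apply/negP; rewrite -leNgt add0r.
rewrite distrC (le_trans _ (ler_norm _))// lerBrDl.
apply/ltW/(le_lt_trans _ (Hb (n k))).
have kn : (k <= n k)%N by apply: mono_leq_infl.
have : rnorm (g 0) + 1 < k%:R.
  rewrite (@lt_le_trans _ _ (Num.truncn (rnorm (g 0) + 1)).+1%:R)//.
    by have /truncn_itv/andP[] : 0 <= rnorm (g 0) + 1
      by rewrite addr_ge0// rnorm_ge0.
  by rewrite ler_nat leq_maxr.
by move=> /ltW /le_trans; apply; rewrite ler_nat.
Qed.

(** Even reflection extends a function on the half-line to a continuous function
    on the whole line, where the measurability lemmas apply. *)
Lemma continuous_absr f : {within halfline R, continuous f} ->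
  continuous (fun x : R => f `|x|).
Proof.
move=> /subspace_continuousP cf x.
have hx : halfline R `|x| by rewrite /halfline/= in_itv/= normr_ge0.
move=> B /(cf _ hx); rewrite /within/=.
move=> H; have H1 := @norm_continuous _ R x _ H.
suff : nbhs x (fun y => B (f `|y|)) by [].
apply: filterS (H1 : nbhs x _) => y /=; apply.
by rewrite /halfline/= in_itv/= normr_ge0.
Qed.

Lemma halflineE x : halfline R x = (0 <= x).
Proof. by rewrite /halfline/= in_itv/= andbT. Qed.

Lemma C0_bounded q : C0 q -> exists M : R, forall t, 0 <= t -> rnorm (q t) <= M.
Proof.
move=> [/continuous_absr cq /cvg_rnormP/(_ _ ltr01)[T [_ HT]]].
have [||c _ Hc] := @EVT_max R (fun x : R => rnorm (q `|x|)) 0 (Num.max T 0).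
- by rewrite le_max lexx orbT.
- by apply: continuous_subspaceT => x; apply: cvg_rnorm; exact: cq.
exists (Num.max 1 (rnorm (q `|c|))) => t t0; rewrite le_max.
have [tT|Tt] := leP t T.
  have := Hc t; rewrite ger0_norm// => -> //; first by rewrite orbT.
  by rewrite in_itv/= t0 le_max tT.
by have /ltW := HT _ Tt; rewrite sub0r rnormN => ->.
Qed.

Section LS.
Variable p : R -> \bar R.
Hypothesis p1 : forall x, unitI R x -> (1 <= p x)%E.

Lemma in_Lp_lim (F : nat -> R -> X) f (M : R) :
  (forall k, continuous (F k)) ->
  (forall x, unitI R x -> F k x @[k --> \oo] --> f x) ->
  (forall x, unitI R x -> rnorm (f x) <= M) -> in_Lp p f.
Proof.
move=> cF Ff fM; apply: (in_Lp_bounded p1 _ fM).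
exact: strongly_measurable_lim cF Ff.
Qed.

Lemma in_LS_lim (I : set R) (F : nat -> R -> X) f (M : R) :
  (forall t x, I t -> unitI R x -> I (x + t)) ->
  (forall k, continuous (F k)) ->
  (forall t, I t -> F k t @[k --> \oo] --> f t) ->
  (forall t, I t -> rnorm (f t) <= M) -> in_LS p I f.
Proof.
move=> IS cF Ff fM; split.
- exact: strongly_measurable_lim cF Ff.
- move=> t It; apply: (@in_Lp_lim (fun k x => F k (x + t)) _ M).
  + move=> k x; apply: (continuous_comp (f := fun x => x + t) (g := F k)).
      by apply: cvgD; [exact: cvg_id|exact: cvg_cst].
    exact: cF.
  + by move=> x Dx; apply: Ff; exact: IS.
  + by move=> x Dx; apply: fM; exact: IS.
- apply: (@le_lt_trans _ _ (Num.max M 1)%:E); last exact: ltry.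
  apply: ge_ereal_sup => _ [t It <-]; apply: luxemburg_le_sup => //.
    by rewrite lt_max ltr01 orbT.
  by move=> x Dx; rewrite le_max fM//; exact: IS.
Qed.

Lemma halfline_unitD t x : halfline R t -> unitI R x -> halfline R (x + t).
Proof.
by rewrite !halflineE /unitI/= in_itv/= => t0 /andP[x0 _]; exact: addr_ge0.
Qed.

(** Continuity of t |-> q (t + _) in the Luxemburg norm is uniform continuity of
    q near [t, t + 1]; both conditions reduce to the supremum norm, which
    dominates the Luxemburg norm. *)
Lemma C0_C0_Lp q : C0 q -> C0_Lp p (fun t x => q (t + x)).
Proof.
move=> Cq; have [M qM] := C0_bounded Cq.
have cq := continuous_absr Cq.1.
split.
- move=> t; rewrite halflineE => t0.
  apply: (@in_Lp_lim (fun _ (x : R) => q `|t + x|) _ M).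
  + move=> _ x; apply: (continuous_comp (f := fun x => t + x)
      (g := fun x : R => q `|x|)).
      by apply: cvgD; [exact: cvg_cst|exact: cvg_id].
    exact: cq.
  + move=> x; rewrite /unitI/= in_itv/= => /andP[x0 _].
    by rewrite (ger0_norm (addr_ge0 t0 x0)); exact: cvg_cst.
  + move=> x; rewrite /unitI/= in_itv/= => /andP[x0 _].
    by rewrite qM// addr_ge0.
- move=> t; rewrite halflineE => t0; apply: luxemburg_cvg0 => e e0.
  have [m Hm] := @continuous_segment_unif R X _ t (t + 1) e cq e0.
  have m0 : 0 < m.+1%:R^-1 :> R by [].
  apply: filterS (nbhsx_ballx t _ m0) => s st; rewrite halflineE => s0.
  apply: luxemburg_le_sup => // x; rewrite /unitI/= in_itv/= => /andP[x0 x1].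
  rewrite rnormB; have := Hm (t + x) (s + x).
  rewrite (ger0_norm (addr_ge0 t0 x0)) (ger0_norm (addr_ge0 s0 x0)); apply.
    by rewrite lerDl x0 lerD2l.
  by rewrite opprD addrACA subrr addr0; exact: ltW.
- apply: luxemburg_cvg0 => e e0.
  have /cvg_rnormP/(_ _ e0)[T [Tr HT]] := Cq.2.
  exists T; split=> // t Tt; apply: luxemburg_le_sup => // x.
  rewrite /unitI/= in_itv/= => /andP[x0 _].
  rewrite -rnormN -sub0r ltW//; apply: HT.
  by rewrite (lt_le_trans Tt)// lerDl.
Qed.

Hypothesis mp : measurable_fun (unitI R : set L) (p : L -> \bar R).
Hypothesis hint : forall l : R, 0 < l ->
  (\int[completed_lebesgue_measure]_(x in (unitI R : set L)) phi (p x) l < +oo)%E.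

(** The form of dominated convergence used for the differences of a function and a
    translate of its limit, which are themselves limits of continuous
    functions. *)
Lemma luxemburg_lim_cvg0 (U : nat -> R -> X) (F : nat -> nat -> R -> X) (M : R) :
  (forall k j, continuous (F k j)) ->
  (forall k x, F k j x @[j --> \oo] --> U k x) ->
  (forall k x, rnorm (U k x) <= M) ->
  (forall x, rnorm (U k x) @[k --> \oo] --> 0) ->
  luxemburg p (U k) @[k --> \oo] --> 0%E.
Proof.
move=> cF FU UM U0.
have mU k := measurable_rnorm_lim (cF k) (FU k).
exact: (luxemburg_dominated_cvg0 p1 mp hint mU (fun k x _ => UM k x)
  (fun x _ => U0 x)).
Qed.

(** The subsequence and the limit g witnessing almost automorphy serve unchanged:
    g inherits the bound of f, so both pointwise convergences become convergences
    in the Luxemburg norm by domination. *)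
Lemma almost_automorphic_Stepanov f :
  almost_automorphic f -> Stepanov_almost_automorphic p f.
Proof.
move=> aaf; have [M fM] := almost_automorphic_bounded aaf.
have [cf sf] := aaf; split.
  apply: (@in_LS_lim setT (fun=> f) f M) => // t _; exact: cvg_cst.
move=> a; have [n [g [incn fg gf]]] := sf a; exists n, g.
have gM t : rnorm (g t) <= M by apply: rnorm_lim_le (fg t) _.
have cfs (h : R -> R) : continuous h -> continuous (f \o h).
  by move=> ch x; apply: continuous_comp; [exact: ch|exact: cf].
have cs (b c : R) : continuous (fun x : R => x + b + c).
  by move=> x; apply: cvgD; [apply: cvgD; [exact: cvg_id|]|]; exact: cvg_cst.
have cfD (h k : R -> R) : continuous (f \o h) -> continuous (f \o k) ->
    continuous (fun x => f (h x) - f (k x)).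
  by move=> ch ck x; apply: cvgB; [exact: ch|exact: ck].
have dM (u v : X) : rnorm u <= M -> rnorm v <= M -> rnorm (u - v) <= M + M.
  by move=> uM vM; rewrite (le_trans (rnormD _ _))// rnormN lerD.
split => //.
- apply: (@in_LS_lim setT (fun k x => f (x + a (n k))) g M) => //.
  move=> k; apply: (cfs (fun x => x + a (n k))) => x.
  by apply: cvgD; [exact: cvg_id|exact: cvg_cst].
- move=> t; apply: (@luxemburg_lim_cvg0 _
    (fun k j x => f (x + a (n k) + t) - f (x + t + a (n j))) (M + M)).
  + by move=> k j; apply: cfD; apply: cfs; exact: cs.
  + move=> k x; rewrite (addrC (a _)); apply: cvgB; [exact: cvg_cst|exact: fg].
  + by move=> k x; exact: dM.
  + move=> x; have := cvg_rnormB0 (fg (x + t)).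
    by under eq_fun do rewrite (addrC (x + t)) addrA; exact.
(* The summand 0 gives both terms the shape x + b + c that cs covers. *)
- move=> t; apply: (@luxemburg_lim_cvg0 _
    (fun k j x => f (x + (- a (n k) + t) + a (n j)) - f (x + t + 0)) (M + M)).
  + by move=> k j; apply: cfD; apply: cfs; exact: cs.
  + by move=> k x; rewrite addr0 -addrA; apply: cvgB; [exact: fg|exact: cvg_cst].
  + by move=> k x; exact: dM.
  + move=> x; have := cvg_rnormB0 (gf (x + t)).
    by under eq_fun do rewrite addrAC; exact.
Qed.

Lemma asymptotically_almost_automorphic_Stepanov f :
  asymptotically_almost_automorphic f ->
  asymptotically_Stepanov_almost_automorphic p f.
Proof.
move=> [g [q [aag Cq fgq]]].
have [Mg gM] := almost_automorphic_bounded aag.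
have [Mq qM] := C0_bounded Cq.
have cq := continuous_absr Cq.1.
have cg := aag.1.
split.
  apply: (@in_LS_lim _ (fun _ (x : R) => g x + q `|x|) f (Mg + Mq)).
  - exact: halfline_unitD.
  - by move=> _ x; apply: cvgD; [exact: cg|exact: cq].
  - move=> t It; rewrite fgq//; move: It; rewrite halflineE => t0.
    by rewrite ger0_norm//; exact: cvg_cst.
  - move=> t It; rewrite fgq// (le_trans (rnormD _ _))// lerD//.
    by apply: qM; rewrite -halflineE.
exists g, q; split => //.
- exact: almost_automorphic_Stepanov.
- apply: (@in_LS_lim _ (fun _ (x : R) => q `|x|) q Mq).
  - exact: halfline_unitD.
  - by [].
  - by move=> t; rewrite halflineE => t0; rewrite ger0_norm//; exact: cvg_cst.
  - by move=> t It; apply: qM; rewrite -halflineE.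
- exact: C0_C0_Lp.
Qed.

End LS.
End AlmostAutomorphic.

Unset Implicit Arguments.

Theorem proposition3p9 (R : realType) (X : completeNormedModType R[i])
    (p : R -> \bar R) (hp : variable_exponent p)
    (hint : forall l : R, 0 < l ->
      (\int[completed_lebesgue_measure]_(x in (unitI R : set (lebesgueType R)))
         phi (p x) l < +oo)%E) :
  (forall f : R -> X,
     almost_automorphic f -> Stepanov_almost_automorphic p f) /\
  (forall f : R -> X,
     asymptotically_almost_automorphic f ->
     asymptotically_Stepanov_almost_automorphic p f).
Proof.
have [mp p1] := hp; split=> f.
  exact: almost_automorphic_Stepanov p1 mp hint f.
exact: asymptotically_almost_automorphic_Stepanov p1 mp hint f.
Qed.
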